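(* Let $n=k+l$ with $k,l\ge 0$. In the algebra $\widetilde{\mathcal B}(n,l)$ the product $B(u)B(-u)$ is a scalar matrix $$B(u)B(-u)=f(u)\,1,$$ where $f(u)$ is an even series in $u^{-1}$ all of whose coefficients are central in $\widetilde{\mathcal B}(n,l)$.
   Context: Let $n=k+l$ with $k,l\ge0$ integers, $\varepsilon_i=1$ for $1\le i\le k$, $\varepsilon_i=-1$ for $k+1\le i\le n$. $\widetilde{\mathcal B}(n,l)$ is the unital associative $\mathbb C$-algebra with generators $b_{ij}^{(r)}$, $r\ge 1$, $1\le i,j\le n$. Put $b_{ij}(u)=\sum_{r\ge 0} b_{ij}^{(r)}u^{-r}$ with $b_{ij}^{(0)}=\delta_{ij}\varepsilon_i$, and $B(u)=\sum_{i,j} b_{ij}(u)\otimes E_{ij}\in\widetilde{\mathcal B}(n,l)[[u^{-1}]]\otimes\mathrm{End}\,\mathbb C^n$ ($E_{ij}$ the matrix units). The only defining relation is the reflection equation $$R(u-v)B_1(u)R(u+v)B_2(v)=B_2(v)R(u+v)B_1(u)R(u-v),$$ where $R(u)=1-Pu^{-1}$, $P=\sum_{i,j}E_{ij}\otimes E_{ji}$, the subscripts $1,2$ show in which copy of $\mathrm{End}\,\mathbb C^n$ the matrix lies, and the relation is understood coefficientwise after multiplying by $u^2-v^2$. ''Scalar matrix'' means an element $f(u)\otimes 1$ with $f(u)\in\widetilde{\mathcal B}(n,l)[[u^{-1}]]$; ''even'' means $f(u)=f(-u)$. *)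

(* Defs.v *)
From HB Require Import structures.
From mathcomp Require Import all_boot all_algebra generic_quotient ring_quotient.
From mathcomp Require Import finmap monalg complex mxtens boolp reals.

Set Implicit Arguments.
Unset Strict Implicit.
Unset Printing Implicit Defensive.

Import GRing.Theory.
Local Open Scope ring_scope.
Local Open Scope quotient_scope.

(* Formal power series A[[t]] over a possibly noncommutative ring A; the
   variable t is central. *)
Record fps (A : Type) := Fps { fcoef : nat -> A }.

HB.instance Definition _ (A : Type) := [isNew for @fcoef A].
HB.instance Definition _ (A : Type) := gen_eqMixin (fps A).
HB.instance Definition _ (A : Type) := gen_choiceMixin (fps A).

Lemma fpsP (A : Type) (f g : fps A) : (forall r, fcoef f r = fcoef g r) <-> f = g.
Proof.
split=> [|-> //]; case: f g => [f] [g] /= fg.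
by congr Fps; apply: funext.
Qed.

Section FpsRing.
Variable A : pzRingType.
Implicit Types f g h : fps A.

Definition fps_zero : fps A := Fps (fun=> 0).
Definition fps_opp f := Fps (fun r => - fcoef f r).
Definition fps_add f g := Fps (fun r => fcoef f r + fcoef g r).

Fact fps_addA : associative fps_add.
Proof. by move=> f g h; apply/fpsP=> r /=; rewrite addrA. Qed.
Fact fps_addC : commutative fps_add.
Proof. by move=> f g; apply/fpsP=> r /=; rewrite addrC. Qed.
Fact fps_add0 : left_id fps_zero fps_add.
Proof. by move=> f; apply/fpsP=> r /=; rewrite add0r. Qed.
Fact fps_addN : left_inverse fps_zero fps_opp fps_add.
Proof. by move=> f; apply/fpsP=> r /=; rewrite addNr. Qed.

HB.instance Definition _ :=
  GRing.isZmodule.Build (fps A) fps_addA fps_addC fps_add0 fps_addN.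

Definition fpsC (a : A) : fps A := Fps (fun r => if r is 0%N then a else 0).
Definition fpsX : fps A := Fps (fun r => (r == 1%N)%:R).
Definition fps_mul f g : fps A :=
  Fps (fun r => \sum_(i < r.+1) fcoef f i * fcoef g (r - i)).

Lemma fcoef_mul_rev f g r :
  fcoef (fps_mul f g) r = \sum_(i < r.+1) fcoef f (r - i) * fcoef g i.
Proof.
rewrite /= (reindex_inj rev_ord_inj) /=.
by apply: eq_bigr => j _; rewrite (sub_ordK j).
Qed.

Fact fps_mulA : associative fps_mul.
Proof.
move=> p q r; apply/fpsP=> i; rewrite [RHS]fcoef_mul_rev.
pose coef3 j k := fcoef p j * (fcoef q (i - j - k) * fcoef r k).
transitivity (\sum_(j < i.+1) \sum_(k < i.+1 | (k <= i - j)%N) coef3 j k).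
  apply: eq_bigr => j _; rewrite fcoef_mul_rev big_distrr /=.
  by rewrite (big_ord_narrow_leq (leq_subr _ _)).
rewrite (exchange_big_dep predT) //=; apply: eq_bigr => k _.
transitivity (\sum_(j < i.+1 | (j <= i - k)%N) coef3 j k).
  apply: eq_bigl => j; rewrite -ltnS -(ltnS j) -!subSn ?leq_ord //.
  by rewrite -subn_gt0 -(subn_gt0 j) -!subnDA addnC.
rewrite (big_ord_narrow_leq (leq_subr _ _)) big_distrl /=.
by apply: eq_bigr => j _; rewrite /coef3 -!subnDA addnC mulrA.
Qed.

Fact fps_mul1 : left_id (fpsC 1) fps_mul.
Proof.
move=> f; apply/fpsP=> r /=; rewrite big_ord_recl subn0 mul1r.
by rewrite big1 ?addr0 // => j _; rewrite mul0r.
Qed.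

Fact fps_mulr1 : right_id (fpsC 1) fps_mul.
Proof.
move=> f; apply/fpsP=> r; rewrite fcoef_mul_rev big_ord_recl subn0 mulr1.
by rewrite big1 ?addr0 // => j _; rewrite mulr0.
Qed.

Fact fps_mulDl : left_distributive fps_mul +%R.
Proof.
move=> f g h; apply/fpsP=> r /=; rewrite -big_split.
by apply: eq_bigr => j _; rewrite mulrDl.
Qed.

Fact fps_mulDr : right_distributive fps_mul +%R.
Proof.
move=> f g h; apply/fpsP=> r /=; rewrite -big_split.
by apply: eq_bigr => j _; rewrite mulrDr.
Qed.

HB.instance Definition _ := GRing.Zmodule_isPzRing.Build (fps A)
  fps_mulA fps_mul1 fps_mulr1 fps_mulDl fps_mulDr.

Fact fpsC_zmod_morphism : zmod_morphism fpsC.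
Proof. by move=> a b; apply/fpsP=> -[|r] //=; rewrite subr0. Qed.
Fact fpsC_monoid_morphism : monoid_morphism fpsC.
Proof.
split=> // a b; apply/fpsP=> -[|r] /=; first by rewrite big_ord1.
rewrite big_ord_recl /= mulr0 add0r big1 // => i _; exact: mul0r.
Qed.
HB.instance Definition _ :=
  GRing.isZmodMorphism.Build A (fps A) fpsC fpsC_zmod_morphism.
HB.instance Definition _ :=
  GRing.isMonoidMorphism.Build A (fps A) fpsC fpsC_monoid_morphism.

(* f(t) |-> f(-t) *)
Definition fps_neg f : fps A := Fps (fun r => (-1) ^+ r * fcoef f r).

End FpsRing.

Arguments fpsC {A} _.
Arguments fpsX {A}.

Definition fps_map (A B : pzRingType) (h : A -> B) (f : fps A) : fps B :=
  Fps (fun r => h (fcoef f r)).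

Section FpsMap.
Variables (A B : pzRingType) (h : {rmorphism A -> B}).

Fact fps_map_zmod_morphism : zmod_morphism (fps_map h).
Proof. by move=> f g; apply/fpsP=> r /=; rewrite rmorphB. Qed.
Fact fps_map_monoid_morphism : monoid_morphism (fps_map h).
Proof.
split=> [|f g]; apply/fpsP=> r /=; first by case: r => [|r]; rewrite ?rmorph1 ?rmorph0.
by rewrite rmorph_sum; apply: eq_bigr => i _; rewrite rmorphM.
Qed.
HB.instance Definition _ :=
  GRing.isZmodMorphism.Build (fps A) (fps B) (fps_map h) fps_map_zmod_morphism.
HB.instance Definition _ :=
  GRing.isMonoidMorphism.Build (fps A) (fps B) (fps_map h) fps_map_monoid_morphism.
End FpsMap.

Fact fps_mulC (A : comPzRingType) : commutative (@fps_mul A).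
Proof.
move=> f g; apply/fpsP=> r; rewrite fcoef_mul_rev.
by apply: eq_bigr => i _; rewrite mulrC.
Qed.
HB.instance Definition _ (A : comPzRingType) :=
  GRing.PzRing_hasCommutativeMul.Build (fps A) (@fps_mulC A).

(* S |-> the two-sided ideal generated by S. *)
Inductive ideal_gen (A : pzRingType) (S : A -> Prop) : A -> Prop :=
| Ideal_gen a : S a -> ideal_gen S a
| Ideal_0 : ideal_gen S 0
| Ideal_add a b : ideal_gen S a -> ideal_gen S b -> ideal_gen S (a + b)
| Ideal_mull a b : ideal_gen S b -> ideal_gen S (a * b)
| Ideal_mulr a b : ideal_gen S a -> ideal_gen S (a * b).

Definition ideal_pred (A : pzRingType) (S : A -> Prop) : {pred A} :=
  fun a => `[< ideal_gen S a >].

Section IdealPred.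
Variables (A : pzRingType) (S : A -> Prop).

Fact ideal_zmod_closed : zmod_closed (ideal_pred S).
Proof.
split=> [|a b]; first exact/asboolP/Ideal_0.
move=> /asboolP Sa /asboolP Sb; apply/asboolP; apply: Ideal_add => //.
by rewrite -mulN1r; apply: Ideal_mull.
Qed.
HB.instance Definition _ :=
  GRing.isZmodClosed.Build A (ideal_pred S) ideal_zmod_closed.
End IdealPred.

Definition alg_quot (A : pzRingType) (S : A -> Prop) : Type :=
  Quotient.quot (ideal_pred S).
HB.instance Definition _ (A : pzRingType) (S : A -> Prop) :=
  GRing.Zmodule.on (alg_quot S).
HB.instance Definition _ (A : pzRingType) (S : A -> Prop) :=
  EqQuotient.on (alg_quot S).

Section AlgQuotRing.
Variables (A : pzRingType) (S : A -> Prop).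
Notation Q := (alg_quot S).

Lemma eq_alg_quot (a b : A) : ideal_gen S (a - b) <-> \pi_Q a = \pi_Q b.
Proof.
split=> [Sab|/eqP]; first by apply/eqP; rewrite piE /Quotient.equiv; apply/asboolP.
by rewrite piE /Quotient.equiv => /asboolP.
Qed.

Lemma alg_quot_repr (a : A) : ideal_gen S (a - repr (\pi_Q a)).
Proof. by apply/eq_alg_quot; rewrite reprK. Qed.

Fact pi_alg_quot_is_zmod_morphism : zmod_morphism (\pi_Q : A -> Q).
Proof. by move=> a b; rewrite !piE. Qed.

Definition alg_quot_one : Q := lift_cst Q 1.
Definition alg_quot_mul := lift_op2 Q *%R.

Lemma pi_alg_quot_one : alg_quot_one = \pi_Q 1.
Proof. by rewrite /alg_quot_one -lock. Qed.

Lemma pi_alg_quot_mul (a b : A) :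
  alg_quot_mul (\pi_Q a) (\pi_Q b) = \pi_Q (a * b).
Proof.
rewrite /alg_quot_mul -lock; apply/esym/eq_alg_quot.
rewrite -(subrK (a * repr (\pi_Q b)) (a * b)) -mulrBr -addrA -mulrBl.
by apply: Ideal_add; [apply: Ideal_mull | apply: Ideal_mulr]; apply: alg_quot_repr.
Qed.

Local Lemma pi_add (a b : A) : \pi_Q a + \pi_Q b = \pi_Q (a + b) :> Q.
Proof. by rewrite !piE. Qed.

Fact alg_quot_mulA : associative alg_quot_mul.
Proof.
by move=> x y z; rewrite -[x]reprK -[y]reprK -[z]reprK !pi_alg_quot_mul mulrA.
Qed.
Fact alg_quot_mul1 : left_id alg_quot_one alg_quot_mul.
Proof. by move=> x; rewrite -[x]reprK pi_alg_quot_one pi_alg_quot_mul mul1r. Qed.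
Fact alg_quot_mulr1 : right_id alg_quot_one alg_quot_mul.
Proof. by move=> x; rewrite -[x]reprK pi_alg_quot_one pi_alg_quot_mul mulr1. Qed.
Fact alg_quot_mulDl : left_distributive alg_quot_mul +%R.
Proof.
move=> x y z; rewrite -[x]reprK -[y]reprK -[z]reprK.
by rewrite pi_add !pi_alg_quot_mul pi_add mulrDl.
Qed.
Fact alg_quot_mulDr : right_distributive alg_quot_mul +%R.
Proof.
move=> x y z; rewrite -[x]reprK -[y]reprK -[z]reprK.
by rewrite pi_add !pi_alg_quot_mul pi_add mulrDr.
Qed.

HB.instance Definition _ := GRing.Zmodule_isPzRing.Build (alg_quot S)
  alg_quot_mulA alg_quot_mul1 alg_quot_mulr1 alg_quot_mulDl alg_quot_mulDr.

Definition alg_proj : A -> alg_quot S := \pi_Q.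

Fact alg_proj_is_zmod_morphism : zmod_morphism alg_proj.
Proof. exact: pi_alg_quot_is_zmod_morphism. Qed.
Fact alg_proj_is_monoid_morphism : monoid_morphism alg_proj.
Proof.
by split=> [|a b]; rewrite /alg_proj -?pi_alg_quot_mul // -pi_alg_quot_one.
Qed.
HB.instance Definition _ :=
  GRing.isZmodMorphism.Build A (alg_quot S) alg_proj alg_proj_is_zmod_morphism.
HB.instance Definition _ :=
  GRing.isMonoidMorphism.Build A (alg_quot S) alg_proj alg_proj_is_monoid_morphism.

End AlgQuotRing.

Section AlgQuotScale.
Variables (K : comNzRingType) (A : algType K) (S : A -> Prop).
Notation Q := (alg_quot S).

Definition alg_quot_scale (c : K) := lift_op1 Q ( *:%R c).

Lemma alg_quot_scale_pi c (a : A) :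
  alg_quot_scale c (\pi_Q a) = \pi_Q (c *: a).
Proof.
rewrite /alg_quot_scale -lock; apply/esym/eq_alg_quot; rewrite -scalerBr -[_ - _]mul1r scalerAl.
by apply: Ideal_mull; apply: alg_quot_repr.
Qed.

Fact alg_quot_scaleA c d x :
  alg_quot_scale c (alg_quot_scale d x) = alg_quot_scale (c * d) x.
Proof. by rewrite -[x]reprK !alg_quot_scale_pi scalerA. Qed.
Fact alg_quot_scale1 : left_id 1 alg_quot_scale.
Proof. by move=> x; rewrite -[x]reprK alg_quot_scale_pi scale1r. Qed.
Fact alg_quot_scaleDr : right_distributive alg_quot_scale +%R.
Proof.
move=> c x y; rewrite -[x]reprK -[y]reprK.
by rewrite pi_add !alg_quot_scale_pi pi_add scalerDr.
Qed.
Fact alg_quot_scaleDl x : {morph alg_quot_scale^~ x : c d / c + d}.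
Proof. by move=> c d; rewrite -[x]reprK !alg_quot_scale_pi pi_add scalerDl. Qed.

HB.instance Definition _ := GRing.Zmodule_isLmodule.Build K (alg_quot S)
  alg_quot_scaleA alg_quot_scale1 alg_quot_scaleDr alg_quot_scaleDl.

Lemma alg_quot_scaleAl (c : K) (x y : Q) : c *: (x * y) = (c *: x) * y.
Proof.
rewrite -[x]reprK -[y]reprK /GRing.mul /GRing.scale /=.
by rewrite !(alg_quot_scale_pi, pi_alg_quot_mul) scalerAl.
Qed.

Lemma alg_quot_scaleAr (c : K) (x y : Q) : c *: (x * y) = x * (c *: y).
Proof.
rewrite -[x]reprK -[y]reprK /GRing.mul /GRing.scale /=.
by rewrite !(alg_quot_scale_pi, pi_alg_quot_mul) scalerAr.
Qed.
End AlgQuotScale.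

Definition free_alg (K : comNzRingType) (I : choiceType) : Type :=
  {malg K[{fmonom I}]}.
HB.instance Definition _ (K : comNzRingType) (I : choiceType) :=
  GRing.Lalgebra.on (free_alg K I).

Fact free_alg_scaleAr (K : comNzRingType) (I : choiceType) (c : K)
  (x y : free_alg K I) : c *: (x * y) = x * (c *: y).
Proof.
apply/malgP=> m; rewrite [LHS]mcoeffZ [in LHS](mcoeffMl x y m).
rewrite [RHS](mcoeffMlw m (fsubset_refl (msupp x)) (msuppZ_le c y)) big_distrr /=.
apply: eq_bigr => m1 _; rewrite big_distrr /=; apply: eq_bigr => m2 _.
by rewrite mcoeffZ mulrnAr mulrCA.
Qed.
HB.instance Definition _ (K : comNzRingType) (I : choiceType) :=
  GRing.Lalgebra_isAlgebra.Build K (free_alg K I) (@free_alg_scaleAr K I).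

Definition free_gen (K : comNzRingType) (I : choiceType) (i : I) :
  free_alg K I := << fmu i >>.

Section Reflection.
Variables (A : pzRingType) (n : nat).

(* x = u^{-1} and y = v^{-1}: the inner series variable is u^{-1}, the outer
   one is v^{-1}. *)
Let x : fps (fps A) := fpsC fpsX.
Let y : fps (fps A) := fpsX.

Definition flip_mx : 'M[fps (fps A)]_(n * n) :=
  \sum_(i < n) \sum_(j < n) delta_mx i j *t delta_mx j i.

(* x y (u - v) R(u - v) = x y (u - v - P) *)
Definition R_minus : 'M[fps (fps A)]_(n * n) := (y - x)%:M - (x * y) *: flip_mx.

(* x y (u + v) R(u + v) = x y (u + v - P) *)
Definition R_plus : 'M[fps (fps A)]_(n * n) := (y + x)%:M - (x * y) *: flip_mx.

Definition B1u (B : 'M[fps A]_n) : 'M[fps (fps A)]_(n * n) :=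
  map_mx fpsC B *t (1%:M : 'M_n).
Definition B2v (B : 'M[fps A]_n) : 'M[fps (fps A)]_(n * n) :=
  (1%:M : 'M_n) *t map_mx (fps_map fpsC) B.

(* The difference of the two sides of the reflection equation, multiplied by
   u^2 - v^2 and then by x^2 y^2. The factor x^2 y^2 clears the positive powers
   of u and v; it shifts the coefficients without changing the set of them. *)
Definition reflection_defect (B : 'M[fps A]_n) : 'M[fps (fps A)]_(n * n) :=
  R_minus *m B1u B *m R_plus *m B2v B - B2v B *m R_plus *m B1u B *m R_minus.

End Reflection.

Arguments flip_mx {A n}.
Arguments R_minus {A n}.
Arguments R_plus {A n}.

Lemma flip_mxE (A : pzRingType) n (i j i' j' : 'I_n) :
  @flip_mx A n (mxtens_index (i, j)) (mxtens_index (i', j')) =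
  ((i == j') && (j == i'))%:R.
Proof.
have dE (a b : 'I_n) :
    (delta_mx a b *t delta_mx b a : 'M[fps (fps A)]_(n * n))
      (mxtens_index (i, j)) (mxtens_index (i', j')) =
    ((i == a) && (j' == a))%:R * ((j == b) && (i' == b))%:R.
  rewrite tensmxE !mxE -!natrM !mulnb; congr (nat_of_bool _)%:R.
  by case: (i == a); case: (i' == b); case: (j == b); case: (j' == a).
have sum_delta (u v : 'I_n) :
    \sum_(a < n) ((u == a) && (v == a))%:R = (u == v)%:R :> fps (fps A).
  rewrite (bigD1 u) // eqxx big1 => [|a /negPf au]; last by rewrite eq_sym au.
  by rewrite /= addr0 eq_sym.
rewrite summxE; under eq_bigr => a _ do
  (rewrite summxE; under eq_bigr => b _ do rewrite dE).
under eq_bigr => a _ do rewrite -mulr_sumr sum_delta.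
by rewrite -mulr_suml sum_delta -natrM mulnb.
Qed.

Lemma mul_flip_mxE (A : pzRingType) n (X : 'M[fps (fps A)]_(n * n)) i j J :
  (flip_mx *m X) (mxtens_index (i, j)) J = X (mxtens_index (j, i)) J.
Proof.
rewrite [LHS]mxE (bigD1 (mxtens_index (j, i))) // flip_mxE !eqxx mul1r.
rewrite big1 => [|I]; first exact: addr0.
case: (mxtens_indexP I) => i1 j1.
rewrite (can_eq (@mxtens_indexK _ _)) xpair_eqE => /negPf neI.
by rewrite flip_mxE (eq_sym i) (eq_sym j) andbC neI mul0r.
Qed.

Lemma mul_mx_flipE (A : pzRingType) n (X : 'M[fps (fps A)]_(n * n)) i j I :
  (X *m flip_mx) I (mxtens_index (i, j)) = X I (mxtens_index (j, i)).
Proof.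
rewrite [LHS]mxE (bigD1 (mxtens_index (j, i))) // flip_mxE !eqxx mulr1.
rewrite big1 => [|J]; first exact: addr0.
case: (mxtens_indexP J) => i1 j1.
rewrite (can_eq (@mxtens_indexK _ _)) xpair_eqE => /negPf neJ.
by rewrite flip_mxE neJ mulr0.
Qed.

Section ReflectionMorphism.
Variables (A B : pzRingType) (h : {rmorphism A -> B}).

Lemma map_fpsC (a : A) : fps_map h (fpsC a) = fpsC (h a).
Proof. by apply/fpsP=> -[|r] //=; rewrite rmorph0. Qed.

Lemma map_fpsX : fps_map h fpsX = fpsX.
Proof. by apply/fpsP=> r /=; rewrite rmorph_nat. Qed.

End ReflectionMorphism.

Section ReflectionDefectMorphism.
Variables (A B : pzRingType) (h : {rmorphism A -> B}) (n : nat).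
Local Notation h2 := (fps_map (fps_map h)).

Lemma map_flip_mx : map_mx h2 (@flip_mx A n) = flip_mx.
Proof.
apply/matrixP=> I J; case: (mxtens_indexP I) => i j.
by case: (mxtens_indexP J) => i' j'; rewrite mxE !flip_mxE rmorph_nat.
Qed.

Lemma map_R_minus : map_mx h2 (@R_minus A n) = R_minus.
Proof.
rewrite /R_minus map_mxB map_scalar_mx map_mxZ map_flip_mx rmorphB rmorphM /=.
by rewrite map_fpsX map_fpsC /= map_fpsX.
Qed.

Lemma map_R_plus : map_mx h2 (@R_plus A n) = R_plus.
Proof.
rewrite /R_plus map_mxB map_scalar_mx map_mxZ map_flip_mx rmorphD rmorphM /=.
by rewrite map_fpsX map_fpsC /= map_fpsX.
Qed.

Lemma map_B1u (M : 'M[fps A]_n) : map_mx h2 (B1u M) = B1u (map_mx (fps_map h) M).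
Proof.
rewrite /B1u map_mxT map_mx1; congr (_ *t _).
by apply/matrixP=> i j; rewrite !mxE /= map_fpsC.
Qed.

Lemma map_B2v (M : 'M[fps A]_n) : map_mx h2 (B2v M) = B2v (map_mx (fps_map h) M).
Proof.
rewrite /B2v map_mxT map_mx1; congr (_ *t _).
by apply/matrixP=> i j; rewrite !mxE; apply/fpsP=> r /=; rewrite map_fpsC.
Qed.

Lemma map_reflection_defect (M : 'M[fps A]_n) :
  map_mx h2 (reflection_defect M) = reflection_defect (map_mx (fps_map h) M).
Proof.
have E (X Y Z W : 'M[fps (fps A)]_(n * n)) : map_mx h2 (X *m Y *m Z *m W) =
    map_mx h2 X *m map_mx h2 Y *m map_mx h2 Z *m map_mx h2 W.
  by rewrite !map_mxM.
rewrite /reflection_defect map_mxB.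
by rewrite ![in LHS]E map_R_minus map_R_plus map_B1u map_B2v.
Qed.
End ReflectionDefectMorphism.

Lemma reflection_aux (A : comPzRingType) m (P M1 M2 : 'M[A]_m) (a b c : A) :
    P *m P = 1%:M -> M1 *m M1 = 1%:M -> M1 *m M2 = M2 *m M1 ->
    P *m M1 = M2 *m P ->
  (a%:M - c *: P) *m M1 *m (b%:M - c *: P) *m M2 =
  M2 *m (b%:M - c *: P) *m M1 *m (a%:M - c *: P).
Proof.
move=> PP M11 M12 PM1.
have M1P : M1 *m P = P *m M2.
  by rewrite -[LHS]mul1mx -PP -!mulmxA (mulmxA P M1) PM1 -!mulmxA PP mulmx1.
have e1 : M1 *m P *m M2 = M2 *m P *m M1.
  by rewrite -PM1 -[LHS]mulmxA -M1P mulmxA -[RHS]mulmxA M11 mul1mx mulmx1.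
have e2 : P *m M1 *m M2 = M2 *m M1 *m P.
  by rewrite PM1 -mulmxA -M1P mulmxA.
have e3 : P *m M1 *m P *m M2 = M2 *m P *m M1 *m P.
  by rewrite PM1 -[RHS]mulmxA M1P mulmxA.
rewrite !(mulmxBl, mulmxBr) !(mul_scalar_mx, mul_mx_scalar).
do ?rewrite -?scalemxAl -?scalemxAr.
rewrite !scalerA e1 e2 e3 M12 (mulrC b a).
by rewrite !opprD !opprK !addrA; congr (_ + _); rewrite addrAC.
Qed.

(* A scalar involution solves the reflection equation. *)
Lemma reflection_defect_const (A : comPzRingType) n (G : 'M[A]_n) :
  G *m G = 1%:M -> reflection_defect (map_mx fpsC G) = 0.
Proof.
move=> GG; pose G2 : 'M[fps (fps A)]_n := map_mx fpsC (map_mx fpsC G).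
have G2G2 : G2 *m G2 = 1%:M by rewrite -!map_mxM GG !map_mx1.
have eqv : map_mx (fps_map fpsC) (map_mx fpsC G) = G2.
  apply/matrixP=> i j; rewrite !mxE; apply/fpsP=> -[|r] //=.
  by apply/fpsP=> -[].
rewrite /reflection_defect /B1u /B2v eqv /R_minus /R_plus -/G2.
set M1 := G2 *t _; set M2 := _ *t G2; set P := flip_mx.
move: (fpsX - fpsC fpsX) (fpsX + fpsC fpsX) (fpsC fpsX * fpsX) => a b c.
have one11 : (1%:M : 'M[fps (fps A)]_n) *t (1%:M : 'M_n) = 1%:M.
  apply/matrixP=> I J; case: (mxtens_indexP I) => i j.
  case: (mxtens_indexP J) => i' j'; rewrite tensmxE !mxE -natrM mulnb.
  by rewrite (can_eq (@mxtens_indexK _ _)) xpair_eqE.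
have M11 : M1 *m M1 = 1%:M by rewrite tensmx_mul G2G2 mulmx1.
have M12 : M1 *m M2 = M2 *m M1 by rewrite [LHS]tensmx_mul [RHS]tensmx_mul !mulmx1 !mul1mx.
have PM1 : P *m M1 = M2 *m P.
  apply/matrixP=> I J; case: (mxtens_indexP I) => i j.
  by case: (mxtens_indexP J) => i' j';
    rewrite [LHS]mul_flip_mxE [RHS]mul_mx_flipE [LHS]tensmxE [RHS]tensmxE mulrC.
have PP : P *m P = 1%:M.
  apply/matrixP=> I J; case: (mxtens_indexP I) => i j.
  case: (mxtens_indexP J) => i' j'; rewrite mul_flip_mxE flip_mxE mxE andbC.
  by rewrite (can_eq (@mxtens_indexK _ _)) xpair_eqE.
by apply/eqP; rewrite subr_eq0; apply/eqP; apply: reflection_aux.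
Qed.

Section ReflectionAlgebra.
Variables (K : comNzRingType) (k l : nat).
Notation n := (k + l)%N.

(* 'I_n starts at 0: i < k here is 1 <= i <= k in 1-based numbering. *)
Definition refl_eps (A : pzRingType) (i : 'I_n) : A :=
  if (i < k)%N then 1 else -1.

(* b_ij^(0) = delta_ij eps_i overrides the value of b at r = 0. *)
Definition refl_mx (A : pzRingType) (b : nat -> 'I_n -> 'I_n -> A) :
    'M[fps A]_n :=
  \matrix_(i, j) Fps (fun r =>
    if r is 0%N then (i == j)%:R * refl_eps A i else b r i j).

(* The generator b_ij^(r), r >= 1, is indexed by (r.-1, i, j). *)
Definition refl_free : algType K := free_alg K (nat * 'I_n * 'I_n)%type.
Definition refl_free_gen (r : nat) (i j : 'I_n) : refl_free :=
  free_gen K (r.-1, i, j).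

Definition refl_relation (a : refl_free) : Prop :=
  exists I J p q,
    a = fcoef (fcoef (reflection_defect (refl_mx refl_free_gen) I J) q) p.

Definition refl_alg : Type := alg_quot refl_relation.
HB.instance Definition _ := GRing.PzRing.on refl_alg.
HB.instance Definition _ := GRing.Lmodule.on refl_alg.

Definition refl_gen (r : nat) (i j : 'I_n) : refl_alg :=
  alg_proj refl_relation (refl_free_gen r i j).

Definition refl_B : 'M[fps refl_alg]_n := refl_mx refl_gen.

(* The character killing all generators sends B(u) to diag(eps). *)
Definition refl_counit : refl_free -> K :=
  @mcoeff {fmonom (nat * 'I_n * 'I_n)%type} K mone.
HB.instance Definition _ := GRing.RMorphism.on refl_counit.

Lemma refl_counit_gen r i j : refl_counit (refl_free_gen r i j) = 0.
Proof. by rewrite /refl_counit /refl_free_gen /free_gen mcoeffU1 fmP fmU fm1. Qed.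

Lemma refl_counit_relation a : refl_relation a -> refl_counit a = 0.
Proof.
move=> [I [J [p [q ->]]]]; set D := reflection_defect _.
have -> : refl_counit (fcoef (fcoef (D I J) q) p) =
    fcoef (fcoef (map_mx (fps_map (fps_map refl_counit)) D I J) q) p.
  by rewrite [map_mx _ D _ _]mxE.
pose G : 'M[K]_n := \matrix_(i, j) ((i == j)%:R * refl_eps K i).
rewrite map_reflection_defect.
have -> : map_mx (fps_map refl_counit) (refl_mx refl_free_gen) = map_mx fpsC G.
  apply/matrixP=> i j; rewrite !mxE; apply/fpsP=> -[|r] /=.
    by rewrite rmorphM rmorph_nat /refl_eps; case: ifP; rewrite ?rmorphN rmorph1.
  exact: refl_counit_gen.
rewrite reflection_defect_const ?mxE //.
apply/matrixP=> i j; rewrite !mxE (bigD1 i) //= !mxE eqxx mul1r big1 => [|m mi].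
  rewrite addr0 mulrCA; case: eqVneq => [->|_]; last by rewrite mul0r.
  by rewrite mul1r /refl_eps; case: ifP; rewrite ?mulr1 // mulrNN mulr1.
by rewrite !mxE eq_sym (negPf mi) !mul0r.
Qed.

Lemma refl_counit_ideal a : ideal_gen refl_relation a -> refl_counit a = 0.
Proof.
elim=> {a}.
- exact: refl_counit_relation.
- exact: rmorph0.
- by move=> a b _ a0 _ b0; rewrite rmorphD /= a0 b0 addr0.
- by move=> a b _ b0; rewrite rmorphM /= b0 mulr0.
- by move=> a b _ a0; rewrite rmorphM /= a0 mul0r.
Qed.

Fact refl_alg_oner_neq0 : 1 != 0 :> refl_alg.
Proof.
apply/eqP; rewrite -(rmorph1 (alg_proj refl_relation)).
rewrite -(rmorph0 (alg_proj refl_relation)) => /eq_alg_quot.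
by rewrite subr0 => /refl_counit_ideal; rewrite rmorph1 => /eqP; rewrite oner_eq0.
Qed.

HB.instance Definition _ :=
  GRing.PzSemiRing_isNonZero.Build refl_alg refl_alg_oner_neq0.
HB.instance Definition _ := GRing.Lmodule_isLalgebra.Build K refl_alg
  (@alg_quot_scaleAl _ _ refl_relation).
HB.instance Definition _ := GRing.Lalgebra_isAlgebra.Build K refl_alg
  (@alg_quot_scaleAr _ _ refl_relation).

End ReflectionAlgebra.

Arguments refl_gen : clear implicits.

(* Main.v *)
From HB Require Import structures.
Require Import Defs.
From mathcomp Require Import all_boot all_algebra complex reals.
From mathcomp Require Import generic_quotient finmap monalg mxtens.

Set Implicit Arguments.
Unset Strict Implicit.
Unset Printing Implicit Defensive.

Import GRing.Theory.
Local Open Scope ring_scope.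

(** Put v = - u in the reflection equation: after clearing denominators the
    factor R(u + v) degenerates to a multiple of P, and comparing matrix entries
    forces B(u)B(-u) and B(-u)B(u) to be one and the same scalar f(u). It is even
    because u |-> - u exchanges the two products. For centrality, R(u)R(-u) is a
    scalar, so multiplying the reflection equation by the one with u replaced by
    - u moves B_2(v) across f(u) up to a factor that is not a zero divisor. *)

(** * Power series over a noncommutative ring: regular elements and the sign change u |-> -u *)

Section FpsTheory.
Variable A : pzRingType.
Implicit Types (a : A) (f g : fps A).

Lemma fcoefM f g r : fcoef (f * g) r = \sum_(i < r.+1) fcoef f i * fcoef g (r - i).
Proof. by []. Qed.

Lemma fcoefB f g r : fcoef (f - g) r = fcoef f r - fcoef g r.
Proof. by []. Qed.

Lemma fcoefN f r : fcoef (- f) r = - fcoef f r.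
Proof. by []. Qed.

Lemma fcoefCM a f r : fcoef (fpsC a * f) r = a * fcoef f r.
Proof.
rewrite fcoefM big_ord_recl subn0 big1 ?addr0 // => i _; exact: mul0r.
Qed.

Lemma fcoefMC a f r : fcoef (f * fpsC a) r = fcoef f r * a.
Proof.
rewrite [LHS]fcoef_mul_rev big_ord_recl subn0 big1 ?addr0 // => i _; exact: mulr0.
Qed.

Lemma fcoefXM f r : fcoef (fpsX * f) r = if r is s.+1 then fcoef f s else 0.
Proof.
rewrite fcoefM big_ord_recl mul0r add0r; case: r => [|r]; first by rewrite big_ord0.
rewrite big_ord_recl mul1r subn1 big1 ?addr0 // => i _; exact: mul0r.
Qed.

Lemma fcoefMX f r : fcoef (f * fpsX) r = if r is s.+1 then fcoef f s else 0.
Proof.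
rewrite [LHS]fcoef_mul_rev big_ord_recl mulr0 add0r.
case: r => [|r]; first by rewrite big_ord0.
rewrite big_ord_recl mulr1 subn1 big1 ?addr0 // => i _; exact: mulr0.
Qed.

Lemma comm_fpsX f : GRing.comm fpsX f.
Proof. by apply/fpsP=> r; rewrite fcoefXM fcoefMX. Qed.

Lemma comm_fpsC a f : (forall b, GRing.comm a b) -> GRing.comm (fpsC a) f.
Proof. by move=> ca; apply/fpsP=> r; rewrite fcoefCM fcoefMC ca. Qed.

(** If f g = 0 and the coefficients of g below r vanish, the coefficient of degree r in f g reduces
    to f_0 g_r. *)
Lemma lreg_fps f : GRing.lreg (fcoef f 0) -> GRing.lreg f.
Proof.
move=> f0; apply: mulrI0_lreg => g fg; apply/fpsP.
elim/ltn_ind => r IHr; apply: f0; rewrite mulr0.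
have: fcoef (f * g) r = 0 by rewrite fg.
rewrite fcoefM big_ord_recl subn0 big1 ?addr0 // => i _.
by rewrite IHr ?mulr0 // ltn_subrL /= (leq_ltn_trans _ (ltn_ord i)).
Qed.

Lemma lreg_fpsX : GRing.lreg (fpsX : fps A).
Proof.
apply: mulrI0_lreg => f Xf; apply/fpsP=> r.
by rewrite -[LHS](fcoefXM f r.+1) Xf.
Qed.

Fact fps_neg_zmod_morphism : zmod_morphism (@fps_neg A).
Proof. by move=> f g; apply/fpsP=> r; rewrite /= mulrBr. Qed.
Fact fps_neg_monoid_morphism : monoid_morphism (@fps_neg A).
Proof.
split=> [|f g]; apply/fpsP=> r; first by case: r => [|r] /=; rewrite ?mulr1 ?mulr0.
rewrite fcoefM /= mulr_sumr; apply: eq_bigr => i _.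
have -> : (-1) ^+ r = (-1) ^+ i * (-1) ^+ (r - i) :> A.
  by rewrite -exprD subnKC // -ltnS.
by rewrite -!mulrA; congr (_ * _); rewrite mulrA -commr_sign -mulrA.
Qed.
HB.instance Definition _ :=
  GRing.isZmodMorphism.Build (fps A) (fps A) (@fps_neg A) fps_neg_zmod_morphism.
HB.instance Definition _ :=
  GRing.isMonoidMorphism.Build (fps A) (fps A) (@fps_neg A) fps_neg_monoid_morphism.

Lemma fps_negK : involutive (@fps_neg A).
Proof. by move=> f; apply/fpsP=> r /=; rewrite mulrA -expr2 sqrr_sign mul1r. Qed.

Lemma fps_negX : fps_neg fpsX = - fpsX :> fps A.
Proof.
apply/fpsP=> r; rewrite fcoefN /=.
by case: eqP => [->|]; rewrite ?expr1 ?mulr1 // mulr0 oppr0.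
Qed.

End FpsTheory.

Lemma fcoef_map (A B : pzRingType) (h : A -> B) (f : fps A) r :
  fcoef (fps_map h f) r = h (fcoef f r).
Proof. by []. Qed.

(** * The substitution v = -u in series in two variables *)

Section FpsAntidiag.
Variable A : pzRingType.
Implicit Types (f g : fps A) (F G : fps (fps A)).

(* The substitution y := - x; by [fps_antidiagX] and [fps_antidiagCX] it kills
   y + x, that is, it corresponds to v := - u. *)
Definition fps_antidiag (F : fps (fps A)) : fps A :=
  Fps (fun r => \sum_(q < r.+1) (-1) ^+ q * fcoef (fcoef F q) (r - q)).

Lemma fcoef_antidiag F r : fcoef (fps_antidiag F) r =
  \sum_(q < r.+1) (-1) ^+ q * fcoef (fcoef F q) (r - q).
Proof. by []. Qed.

Fact fps_antidiag_zmod_morphism : zmod_morphism fps_antidiag.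
Proof.
move=> F G; apply/fpsP=> r; rewrite fcoefB /= -sumrB; apply: eq_bigr => q _.
by rewrite -mulrBr.
Qed.
HB.instance Definition _ := GRing.isZmodMorphism.Build (fps (fps A)) (fps A)
  fps_antidiag fps_antidiag_zmod_morphism.

Lemma fps_antidiagX F : fps_antidiag (fpsX * F) = - (fpsX * fps_antidiag F).
Proof.
apply/fpsP=> r; rewrite fcoefN fcoefXM fcoef_antidiag big_ord_recl fcoefXM.
rewrite mulr0 add0r.
case: r => [|r]; first by rewrite big_ord0 oppr0.
by rewrite -sumrN; apply: eq_bigr => q _; rewrite fcoefXM exprS mulN1r mulNr.
Qed.

Lemma fps_antidiagCX F : fps_antidiag (fpsC fpsX * F) = fpsX * fps_antidiag F.
Proof.
apply/fpsP=> r; rewrite fcoefXM fcoef_antidiag big_ord_recr fcoefCM subnn fcoefXM.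
rewrite mulr0 [LHS]addr0.
case: r => [|r]; first by rewrite big_ord0.
apply: eq_bigr => q _; rewrite fcoefCM fcoefXM.
by rewrite /= (subSn (leq_ord q)).
Qed.

(** Here [fpsC f] stands for f(u) and [fps_map fpsC g] for g(v). *)
Lemma fps_antidiagCM f g :
  fps_antidiag (fpsC f * fps_map fpsC g) = f * fps_neg g.
Proof.
apply/fpsP=> r; rewrite [RHS]fcoef_mul_rev; apply: eq_bigr => q _.
by rewrite fcoefCM fcoef_map fcoefMC /= !mulrA commr_sign.
Qed.

Lemma fps_antidiagMC f g :
  fps_antidiag (fps_map fpsC g * fpsC f) = fps_neg g * f.
Proof.
apply/fpsP=> r; apply: eq_bigr => q _.
by rewrite fcoefMC fcoef_map fcoefCM /= !mulrA.
Qed.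

End FpsAntidiag.

(** * Tensor products with an identity factor, over a noncommutative ring *)

Section TensorTheory.
Variables (S : pzRingType) (n : nat).
Implicit Types X Y : 'M[S]_n.

Lemma eq_tensmxP (M N : 'M[S]_(n * n)) :
  (forall i j k l, M (mxtens_index (i, j)) (mxtens_index (k, l)) =
                   N (mxtens_index (i, j)) (mxtens_index (k, l))) -> M = N.
Proof.
move=> eqMN; apply/matrixP=> I J; case: (mxtens_indexP I) => i j.
by case: (mxtens_indexP J) => k l; apply: eqMN.
Qed.

Lemma tens_mx1E X i j k l :
  (X *t (1%:M : 'M_n)) (mxtens_index (i, j)) (mxtens_index (k, l)) =
  X i k *+ (j == l).
Proof. by rewrite tensmxE mxE mulr_natr. Qed.

Lemma tens_1mxE X i j k l :
  ((1%:M : 'M_n) *t X) (mxtens_index (i, j)) (mxtens_index (k, l)) =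
  X j l *+ (i == k).
Proof. by rewrite tensmxE mxE mulr_natl. Qed.

(** The mixed product rule for tensors can fail when entries do not commute. With identity second
    factors no entry of [X] has to pass an entry of [Y]. *)
Lemma tens_mx1_mul X Y :
  (X *t (1%:M : 'M_n)) *m (Y *t (1%:M : 'M_n)) = (X *m Y) *t (1%:M : 'M_n).
Proof.
apply: eq_tensmxP => i j k l; rewrite [LHS]mxE [RHS]tens_mx1E [in RHS]mxE -sumrMnl.
rewrite (reindex (@mxtens_index n n)) /=; last first.
  by exists (@mxtens_unindex n n) => p _; rewrite (mxtens_indexK, mxtens_unindexK).
pose G p q := (X *t (1%:M : 'M_n)) (mxtens_index (i, j)) (mxtens_index (p, q)) *
  (Y *t (1%:M : 'M_n)) (mxtens_index (p, q)) (mxtens_index (k, l)).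
transitivity (\sum_p G p.1 p.2); first by apply: eq_bigr => -[].
rewrite -(pair_bigA _ G) /G.
apply: eq_bigr => p _; rewrite (bigD1 j) //= !tens_mx1E eqxx mulrnAr.
rewrite big1 ?addr0 // => q /negPf jq.
by rewrite !tens_mx1E eq_sym jq mul0r.
Qed.

Lemma tens_scalar_mx1 (c : S) :
  (c%:M : 'M_n) *t (1%:M : 'M_n) = (c%:M : 'M_(n * n)).
Proof.
apply: eq_tensmxP => i j k l; rewrite tens_mx1E !mxE.
by rewrite (can_eq (@mxtens_indexK _ _)) xpair_eqE -mulrnA mulnb.
Qed.

Lemma tens_1scalar_mx (c : S) :
  (1%:M : 'M_n) *t (c%:M : 'M_n) = (c%:M : 'M_(n * n)).
Proof.
apply: eq_tensmxP => i j k l; rewrite tens_1mxE !mxE.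
by rewrite (can_eq (@mxtens_indexK _ _)) xpair_eqE -mulrnA mulnb andbC.
Qed.

Lemma scalar_mx_central (c : S) (M : 'M[S]_n) :
  (forall z, GRing.comm c z) -> c%:M *m M = M *m c%:M.
Proof.
move=> cc; rewrite mul_scalar_mx; apply/matrixP=> i j; rewrite !mxE (bigD1 j) //=.
by rewrite big1 ?addr0 => [|k /negPf kj]; rewrite mxE ?eqxx ?cc // kj mulr0.
Qed.

End TensorTheory.

(** * The permutation operator P *)

Section FlipTheory.
Variables (A : pzRingType) (n : nat).
Local Notation S := (fps (fps A)).
Local Notation P := (@flip_mx A n).
Implicit Types X Y : 'M[S]_n.

Lemma flip_mxK : P *m P = 1%:M.
Proof.
apply: eq_tensmxP => i j k l; rewrite mul_flip_mxE flip_mxE mxE.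
by rewrite (can_eq (@mxtens_indexK _ _)) xpair_eqE andbC.
Qed.

Lemma flip_tens_mx1 X : P *m (X *t (1%:M : 'M_n)) = ((1%:M : 'M_n) *t X) *m P.
Proof.
apply: eq_tensmxP => i j k l.
by rewrite mul_flip_mxE mul_mx_flipE tens_mx1E tens_1mxE.
Qed.

Lemma tens_1mx_flip X : (1%:M : 'M_n) *t X = P *m (X *t (1%:M : 'M_n)) *m P.
Proof. by rewrite flip_tens_mx1 -mulmxA flip_mxK mulmx1. Qed.

(** The scalar matrix is [c] tensor 1 as well as 1 tensor [c], and P exchanges the two. This is
    applied to f(u) before f is known to be central. *)
Lemma comm_flip_scalar (c : S) : c%:M *m P = P *m c%:M.
Proof. by rewrite -{2}tens_scalar_mx1 flip_tens_mx1 tens_1scalar_mx. Qed.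

End FlipTheory.

(** * The R-matrices and the ring identity behind centrality *)

Section RMatrix.
Variables (A : pzRingType) (n : nat).
Local Notation S := (fps (fps A)).
Local Notation x := (fpsC fpsX : S).
Local Notation y := (fpsX : S).

(** Products with scalar matrices replace scaling, so that identities proved in an abstract ring
    apply to the matrix ring. *)
Lemma R_minusE :
  @R_minus A n = (y - x)%:M - (x * y)%:M *m flip_mx.
Proof. by rewrite mul_scalar_mx. Qed.

Lemma R_plusE :
  @R_plus A n = (y + x)%:M - (x * y)%:M *m flip_mx.
Proof. by rewrite mul_scalar_mx. Qed.

Let comm_x (z : S) : GRing.comm x z.
Proof. by apply: comm_fpsC => w; apply: comm_fpsX. Qed.

Let comm_y (z : S) : GRing.comm y z.
Proof. exact: comm_fpsX. Qed.

Lemma scalar_minus_central (M : 'M[S]_n) : GRing.comm (y - x)%:M M.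
Proof.
by apply: scalar_mx_central => z; apply/commr_sym/commrB; apply: commr_sym.
Qed.

Lemma scalar_plus_central (M : 'M[S]_n) : GRing.comm (y + x)%:M M.
Proof.
by apply: scalar_mx_central => z; apply/commr_sym/commrD; apply: commr_sym.
Qed.

Lemma scalar_mul_central (M : 'M[S]_n) : GRing.comm (x * y)%:M M.
Proof.
by apply: scalar_mx_central => z; apply/commr_sym/commrM; apply: commr_sym.
Qed.

End RMatrix.

(* With a := u - v, b := u + v and c := 1, up to clearing denominators: the
   factors on the left are those of R(u-v)R(v-u) and R(u+v)R(-u-v). *)
Lemma reflection_center (S : pzRingType) (a b c P B B' F M : S) :
    (forall z, GRing.comm a z) -> (forall z, GRing.comm b z) ->
    (forall z, GRing.comm c z) -> P * P = 1 -> B * B' = F -> F * P = P * F ->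
    (a - c * P) * B * (b - c * P) * M = M * (b - c * P) * B * (a - c * P) ->
    (b + c * P) * B' * (a + c * P) * M = M * (a + c * P) * B' * (b + c * P) ->
  (a * a - c * c) * (b * b - c * c) * (F * M - M * F) = 0.
Proof.
move=> Za Zb Zc PP BB FP eq1 eq2.
(* This is the scalar R(z)R(-z) with denominators cleared; it rests on P^2 = 1. *)
have zP (d : S) : (forall z, GRing.comm d z) ->
    (d - c * P) * (d + c * P) = d * d - c * c.
  move=> Zd; rewrite mulrDr !mulrBl -(Zd (c * P)) addrA subrK.
  by rewrite mulrA -(mulrA c P c) -(Zc P) !mulrA -(mulrA _ P) PP mulr1.
have Zsq (d e : S) : (forall z, GRing.comm d z) -> (forall z, GRing.comm e z) ->
    forall z, GRing.comm (d * d - e * e) z.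
  by move=> Zd Ze z; apply/commr_sym/commrB; apply: commrM; apply: commr_sym.
have FD (d : S) : (forall z, GRing.comm d z) -> F * (d + c * P) = (d + c * P) * F.
  by move=> Zd; rewrite mulrDl mulrDr Zd -mulrA -FP !mulrA Zc.
have zPa := zP a Za; have zPb := zP b Zb.
have Zal := Zsq a c Za Zc; have Zbe := Zsq b c Zb Zc.
move: (a * a - c * c) (b * b - c * c) zPa zPb Zal Zbe => al be zPa zPb Zal Zbe.
have FPa := FD a Za; have FPb := FD b Zb.
move: (a - c * P) (a + c * P) (b - c * P) (b + c * P) zPa zPb FPa FPb eq1 eq2.
move=> p q r s pq rs Fq Fs eq1 eq2.
(* In the first product [r * s] collapses to [be], then B B' = F moves past [q] and [p * q] gives
   [al]. In the second, [p * q] collapses first and [r * s] last. *)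
have ->: al * be * (F * M - M * F) =
    p * B * r * (s * B' * q * M) - M * r * B * p * (q * B' * s).
  have -> : p * B * r * (s * B' * q * M) = be * (p * (B * B') * q * M).
    rewrite -(mulrA p B r) !mulrA -(mulrA _ r s) rs.
    by rewrite -Zbe !mulrA.
  have -> : M * r * B * p * (q * B' * s) = al * (M * r * (B * B') * s).
    rewrite !mulrA -(mulrA _ p q) pq.
    by rewrite -Zal !mulrA.
  rewrite BB -(mulrA p) Fq (mulrA p) pq -(mulrA (M * r)) Fs.
  rewrite (mulrA (M * r)) -(mulrA M) rs -Zbe -!mulrA mulrBr mulrBr.
  by rewrite !mulrA -(mulrA al M) -(Zbe M) !mulrA (Zal be).
(* The equation for -u carries [M] to the left of [q * B' * s], and the one for u then carries it to
   the left of [r * B * p]. *)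
by rewrite eq2 -eq1 !mulrA subrr.
Qed.

(** * The reflection equation specialized at v = -u *)

(** The terms are sorted so as to isolate the multiple of [b], which stands for u + v and vanishes
    at v = -u. The other terms come from the P in R(u + v). *)
Lemma reflection_expand (T : pzRingType) (a b c P B M : T) :
    (forall z, GRing.comm a z) -> (forall z, GRing.comm b z) ->
    (forall z, GRing.comm c z) ->
  (a - c * P) * B * (b - c * P) * M - M * (b - c * P) * B * (a - c * P) =
  b * ((a - c * P) * B * M - M * B * (a - c * P))
    - a * (c * (B * P * M - M * P * B)) + c * (c * (P * B * P * M - M * P * B * P)).
Proof.
move=> Za Zb Zc.
have CA (d X Y : T) : (forall z, GRing.comm d z) -> X * (d * Y) = d * (X * Y).
  by move=> Zd; rewrite mulrA -Zd mulrA.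
have pull (X Y : T) : X * (b - c * P) * Y = b * (X * Y) - c * (X * P * Y).
  by rewrite mulrBr -(Zb X) (CA c) // mulrBl !mulrA.
have E1 : (a - c * P) * B * (b - c * P) * M =
    b * ((a - c * P) * B * M) - a * (c * (B * P * M)) + c * (c * (P * B * P * M)).
  rewrite pull -addrA; congr (_ + _).
  by rewrite !mulrBl mulrBr opprB addrC -!mulrA (CA c a).
have E2 : M * (b - c * P) * B * (a - c * P) =
    b * (M * B * (a - c * P)) - a * (c * (M * P * B)) + c * (c * (M * P * B * P)).
  rewrite -(mulrA _ B) pull !mulrA -addrA; congr (_ + _).
  rewrite -!mulrA (mulrBr B) -(Za B) (CA c B) // !mulrBr.
  by rewrite (CA a P) // (CA c P) // (CA a M) // (CA c M) // (CA a c) // opprB addrC.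
by rewrite E1 E2 !mulrBr !opprD !opprK addrACA;
  congr (_ + _); rewrite addrACA.
Qed.

Lemma scalar_mx_expandE (S : pzRingType) m (a b c : S) (G U U' V V' : 'M[S]_m) I J :
  (b%:M *m G - a%:M *m (c%:M *m (U - U')) + c%:M *m (c%:M *m (V - V'))) I J =
  b * G I J - a * (c * (U I J - U' I J)) + c * (c * (V I J - V' I J)).
Proof. by rewrite !mul_scalar_mx !mxE. Qed.

(** Used with M = B_1(u), N = B_1(v) and W = B_2(v): each product then contains only B(u)B(v) or
    B(v)B(u) within one tensor copy, up to outer factors P. *)
Lemma flip_cancel (T : pzRingType) (P M N W : T) : P * P = 1 -> W = P * N * P ->
  [/\ M * P * W = M * N * P, W * P * M = P * (N * M),
      P * M * P * W = P * (M * N) * P & W * P * M * P = P * (N * M) * P].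
Proof.
move=> PP ->; split; rewrite !mulrA ?(mulrA _ P) -?(mulrA _ P P) ?PP ?mulr1 //.
Qed.

Section ReflectionConsequences.
Variables (A : pzRingType) (n : nat) (B : 'M[fps A]_n).
Local Notation S := (fps (fps A)).
Local Notation P := (@flip_mx A n).
Local Notation x := (fpsC fpsX : S).
Local Notation y := (fpsX : S).
Let Bneg := map_mx (@fps_neg _) B.
Hypothesis refl0 : reflection_defect B = 0.

Let X := map_mx (@fpsC (fps A)) B.
Let Z := map_mx (fps_map (@fpsC A)) B.

Let B2vE : B2v B = P *m (Z *t (1%:M : 'M_n)) *m P.
Proof. exact: tens_1mx_flip. Qed.

Let antidiag_XZ i j : fps_antidiag ((X *m Z) i j) = (B *m Bneg) i j.
Proof.
rewrite !mxE raddf_sum; apply: eq_bigr => k _.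
by rewrite !mxE; apply: fps_antidiagCM.
Qed.

Let antidiag_ZX i j : fps_antidiag ((Z *m X) i j) = (Bneg *m B) i j.
Proof.
rewrite !mxE raddf_sum; apply: eq_bigr => k _.
by rewrite !mxE; apply: fps_antidiagMC.
Qed.



(** The cofactor [F] of y + x can stay unspecified, because its term dies under [fps_antidiag]. The
    entries are parameters so that they can be supplied in simplified form. *)
Lemma reflection_defectE I J (u u' v v' : S) :
    (B1u B *m P *m B2v B) I J = u -> (B2v B *m P *m B1u B) I J = u' ->
    (P *m B1u B *m P *m B2v B) I J = v -> (B2v B *m P *m B1u B *m P) I J = v' ->
  exists F : S, reflection_defect B I J = (y + x) * F
    - (y - x) * (x * y * (u - u')) + x * y * (x * y * (v - v')).
Proof.
move=> <- <- <- <-.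
exists ((R_minus *m B1u B *m B2v B - B2v B *m B1u B *m R_minus) I J).
have -> : reflection_defect B =
    (y + x)%:M *m (R_minus *m B1u B *m B2v B - B2v B *m B1u B *m R_minus)
    - (y - x)%:M *m ((x * y)%:M *m (B1u B *m P *m B2v B - B2v B *m P *m B1u B))
    + (x * y)%:M *m ((x * y)%:M *m
        (P *m B1u B *m P *m B2v B - B2v B *m P *m B1u B *m P)).
  rewrite /reflection_defect R_minusE R_plusE.
  exact: (@reflection_expand 'M[S]_(n * n)%N _ _ _ P (B1u B) (B2v B)
    (@scalar_minus_central A (n * n)) (@scalar_plus_central A (n * n))
    (@scalar_mul_central A (n * n))).
exact: scalar_mx_expandE.
Qed.

Let antidiag_plus (F : S) : fps_antidiag ((y + x) * F) = 0.
Proof. by rewrite mulrDl raddfD /= fps_antidiagX fps_antidiagCX addNr. Qed.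
Let antidiag_minus (F : S) :
  fps_antidiag ((y - x) * F) = - (fpsX * fps_antidiag F *+ 2).
Proof.
by rewrite mulrBl raddfB /= fps_antidiagX fps_antidiagCX mulr2n opprD.
Qed.
Let antidiag_mul (F : S) :
  fps_antidiag (x * y * F) = - (fpsX * (fpsX * fps_antidiag F)).
Proof. by rewrite -mulrA fps_antidiagCX fps_antidiagX mulrN. Qed.

Let antidiag_defect (F u u' v v' : S) :
  fps_antidiag ((y + x) * F - (y - x) * (x * y * (u - u'))
                + x * y * (x * y * (v - v'))) =
  fpsX * (fpsX * (fpsX *
    (fpsX * fps_antidiag (v - v') - fps_antidiag (u - u') *+ 2))).
Proof.
move: (u - u') (v - v') => p q.
rewrite raddfD raddfB /= antidiag_plus antidiag_minus !antidiag_mul sub0r opprK.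
by rewrite !mulrN !opprK !mulrBr !mulrnAr mulNrn addrC.
Qed.

Let antidiag_entry i l j k (b b' : bool) :
  fps_antidiag ((X *m Z) i l *+ b - (Z *m X) j k *+ b') =
  (B *m Bneg) i l *+ b - (Bneg *m B) j k *+ b'.
Proof. by rewrite -antidiag_XZ -antidiag_ZX raddfB !raddfMn. Qed.

(** At y = -x the factors y - x and x y become -2x and -x^2. The defect turns into x^3 times the
    difference of the two sides, and x is regular. *)
Lemma reflection_antidiag i j k l :
  fpsX * ((B *m Bneg) j l *+ (i == k) - (Bneg *m B) j l *+ (i == k)) =
  ((B *m Bneg) i l *+ (j == k) - (Bneg *m B) j k *+ (i == l)) *+ 2.
Proof.
have [E1 E2 E3 E4] := @flip_cancel 'M[S]_(n * n)%N P (B1u B)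
  (Z *t (1%:M : 'M_n)) (B2v B) (@flip_mxK A n) B2vE.
have XZ : B1u B *m (Z *t (1%:M : 'M_n)) = (X *m Z) *t (1%:M : 'M_n).
  exact: tens_mx1_mul.
have ZX : (Z *t (1%:M : 'M_n)) *m B1u B = (Z *m X) *t (1%:M : 'M_n).
  exact: tens_mx1_mul.
pose conjP (M : 'M[S]_(n * n)) := P *m M *m P.
pose ent (M : 'M[S]_(n * n)) := M (mxtens_index (i, j)) (mxtens_index (k, l)).
have U : ent (B1u B *m P *m B2v B) = (X *m Z) i l *+ (j == k).
  apply: etrans (congr1 ent (etrans E1 (congr1 (mulmx^~ P) XZ))) _.
  exact: etrans (mul_mx_flipE _ _ _ _) (tens_mx1E _ i j l k).
have U' : ent (B2v B *m P *m B1u B) = (Z *m X) j k *+ (i == l).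
  apply: etrans (congr1 ent (etrans E2 (congr1 (mulmx P) ZX))) _.
  exact: etrans (mul_flip_mxE _ _ _ _) (tens_mx1E _ j i k l).
have V : ent (P *m B1u B *m P *m B2v B) = (X *m Z) j l *+ (i == k).
  apply: etrans (congr1 ent (etrans E3 (etrans (congr1 conjP XZ) _))) _.
    exact: esym (tens_1mx_flip _).
  exact: tens_1mxE.
have V' : ent (B2v B *m P *m B1u B *m P) = (Z *m X) j l *+ (i == k).
  apply: etrans (congr1 ent (etrans E4 (etrans (congr1 conjP ZX) _))) _.
    exact: esym (tens_1mx_flip _).
  exact: tens_1mxE.
have [F] := reflection_defectE U U' V V'.
rewrite refl0 [X in X = _]mxE => /(congr1 (@fps_antidiag A)).
move=> /esym/(etrans (esym (antidiag_defect _ _ _ _ _))).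
(* The three factors [fpsX] are cancelled one by one. *)
have XK := @lreg_fpsX A.
rewrite raddf0 -[X in _ = X](mulr0 fpsX) => /XK.
rewrite -[X in _ = X](mulr0 fpsX) => /XK.
rewrite -[X in _ = X](mulr0 fpsX) => /XK.
rewrite (antidiag_entry j l j l) (antidiag_entry i l j k).
exact: subr0_eq.
Qed.

End ReflectionConsequences.

(** * B(u)B(-u) is scalar and even *)

Section ReflectionScalar.
Variables (A : pzRingType) (n : nat) (B : 'M[fps A]_n).
Let Bneg := map_mx (@fps_neg _) B.
Hypothesis refl0 : reflection_defect B = 0.
Hypothesis two_reg : forall a : A, a *+ 2 = 0 -> a = 0.

Let fps_two_reg (f : fps A) : f *+ 2 = 0 -> f = 0.
Proof.
move=> f2; apply/fpsP=> r; apply: two_reg.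
by rewrite -[RHS](congr1 (@fcoef A ^~ r) f2).
Qed.

(** Comparing coefficients gives 2 f_0 = 0 and 2 f_(r+1) = f_r, so all of them vanish by
    induction. *)
Let fpsX_two_reg (f : fps A) : fpsX * f = f *+ 2 -> f = 0.
Proof.
move=> Xf; apply/fpsP; elim=> [|r IHr]; apply: two_reg.
  by rewrite -[LHS](congr1 (@fcoef A ^~ 0) Xf) fcoefXM.
by rewrite -[LHS](congr1 (@fcoef A ^~ r.+1) Xf) fcoefXM IHr.
Qed.

(** Suitable choices of the four indices in [reflection_antidiag] give every entry. Evenness follows
    because u |-> -u exchanges the two products, whose diagonals agree. *)
Lemma reflection_scalar : exists f : fps A,
  [/\ B *m Bneg = f%:M, Bneg *m B = f%:M & fps_neg f = f].
Proof.
have E := reflection_antidiag refl0; rewrite -/Bneg in E.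
have negBB : map_mx (@fps_neg A) (B *m Bneg) = Bneg *m B.
  rewrite map_mxM; congr (_ *m _); apply/matrixP=> i j; rewrite !mxE.
  exact: fps_negK.
move: E negBB; move: (B *m Bneg) (Bneg *m B) => C D E negC.
have CD i : C i i = D i i.
  apply/eqP; rewrite -subr_eq0; apply/eqP; apply: fpsX_two_reg.
  by have:= E i i i i; rewrite eqxx.
(* For i different from k the side multiplied by [fpsX] is zero, and the factor 2 can be
   cancelled. *)
have Eneq i j k l : i != k -> C i l *+ (j == k) = D j k *+ (i == l).
  move=> /negPf ik; apply/eqP; rewrite -subr_eq0; apply/eqP; apply: fps_two_reg.
  by rewrite -E ik subrr mulr0.
have offC i l : i != l -> C i l = 0.
  by move=> il; have:= Eneq i l l l il; rewrite eqxx (negPf il).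
have offD j k : j != k -> D j k = 0.
  by move=> jk; have:= Eneq j j k j jk; rewrite eqxx (negPf jk).
have CDi i k : C i i = D k k.
  have [->//|ik] := eqVneq i k.
  by have:= Eneq i k k i ik; rewrite !eqxx.
move: C D negC CD offC offD CDi {E Eneq} => C D.
(* For n = 0 the matrices are empty and there is no diagonal entry to choose, so the even series 1
   serves as f. *)
case: n C D => [|m] C D negC CD offC offD CDi.
  exists 1; split; last exact: rmorph1.
    by apply/matrixP=> -[].
  by apply/matrixP=> -[].
exists (C ord0 ord0); split.
- apply/matrixP=> i j; rewrite mxE; case: eqVneq => [<-|/offC //].
  by rewrite mulr1n (CDi i ord0) (CDi ord0 ord0).
- apply/matrixP=> i j; rewrite mxE; case: eqVneq => [<-|/offD //].
  by rewrite mulr1n -(CDi ord0 i).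
- by rewrite [RHS]CD -negC mxE.
Qed.

End ReflectionScalar.

(** * Centrality of the coefficients of f *)

Lemma scalar_mx_commE (S : pzRingType) m (d c : S) (M : 'M[S]_m) I J :
  (d%:M *m (c%:M *m M - M *m c%:M)) I J = d * (c * M I J - M I J * c).
Proof.
have McE : (M *m c%:M) I J = M I J * c.
  rewrite mxE (bigD1 J) //= big1 ?addr0 => [|k /negPf kJ]; rewrite mxE ?eqxx //.
  by rewrite kJ mulr0.
rewrite mul_scalar_mx [c%:M *m M]mul_scalar_mx mxE [in LHS]mxE [in LHS]mxE.
by rewrite -McE mxE.
Qed.

Lemma scalar_mx_prodB (S : pzRingType) m (a b c : S) :
  ((a * a - c * c) * (b * b - c * c))%:M =
  (a%:M *m a%:M - c%:M *m c%:M) *m (b%:M *m b%:M - c%:M *m c%:M) :> 'M_m.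
Proof. by rewrite scalar_mxM !raddfB /= !scalar_mxM. Qed.

Section ReflectionCenter.
Variables (A : pzRingType) (n : nat) (B : 'M[fps A]_n) (f : fps A).
Local Notation S := (fps (fps A)).
Local Notation P := (@flip_mx A n).
Local Notation x := (fpsC fpsX : S).
Local Notation y := (fpsX : S).
Local Notation neg1 := (fps_map (@fps_neg A)).
Let Bneg := map_mx (@fps_neg _) B.
Hypothesis refl0 : reflection_defect B = 0.
Hypothesis BBneg : B *m Bneg = f%:M.

Let neg1x : neg1 x = - x.
Proof. by rewrite map_fpsC /= fps_negX rmorphN. Qed.

Let neg1y : neg1 y = y.
Proof. exact: map_fpsX. Qed.

Let neg1P : map_mx neg1 P = P.
Proof. by apply: eq_tensmxP => i j k l; rewrite mxE !flip_mxE rmorph_nat. Qed.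

Let neg1B1u : map_mx neg1 (B1u B) = B1u Bneg.
Proof.
rewrite /B1u map_mxT map_mx1; congr (_ *t _).
by apply/matrixP=> i j; rewrite !mxE; apply: map_fpsC.
Qed.

Let neg1B2v : map_mx neg1 (B2v B) = B2v B.
Proof.
rewrite /B2v map_mxT map_mx1; congr (_ *t _).
apply/matrixP=> i j; rewrite !mxE; apply/fpsP=> r; apply/fpsP=> -[|q] /=.
  by rewrite mul1r.
by rewrite mulr0.
Qed.

(** [neg1] is u |-> -u with v fixed. It sends u - v - P to -(u + v + P), and the clearing factor x y
    changes sign as well. *)
Let neg1R_minus :
  map_mx neg1 (@R_minus A n) = (y + x)%:M + (x * y)%:M *m P.
Proof.
rewrite /R_minus map_mxB map_scalar_mx map_mxZ neg1P rmorphB rmorphM /=.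
by rewrite neg1x neg1y opprK mulNr scaleNr opprK mul_scalar_mx.
Qed.

Let neg1R_plus :
  map_mx neg1 (@R_plus A n) = (y - x)%:M + (x * y)%:M *m P.
Proof.
rewrite /R_plus map_mxB map_scalar_mx map_mxZ neg1P rmorphD rmorphM /=.
by rewrite neg1x neg1y mulNr scaleNr opprK mul_scalar_mx.
Qed.

Let refl_eq : R_minus *m B1u B *m R_plus *m B2v B =
              B2v B *m R_plus *m B1u B *m R_minus.
Proof. exact: subr0_eq. Qed.

Let refl_eq_neg :
  ((y + x)%:M + (x * y)%:M *m P) *m B1u Bneg *m ((y - x)%:M + (x * y)%:M *m P)
    *m B2v B =
  B2v B *m ((y - x)%:M + (x * y)%:M *m P) *m B1u Bneg
    *m ((y + x)%:M + (x * y)%:M *m P).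
Proof.
rewrite -neg1R_minus -neg1R_plus -neg1B1u -neg1B2v.
have E (X Y Z W : 'M[S]_(n * n)) : map_mx neg1 X *m map_mx neg1 Y *m
    map_mx neg1 Z *m map_mx neg1 W = map_mx neg1 (X *m Y *m Z *m W).
  by rewrite !map_mxM.
exact: etrans (E _ _ _ _) (etrans (congr1 (map_mx neg1) refl_eq) (esym (E _ _ _ _))).
Qed.

Let B1uBneg : B1u B *m B1u Bneg = (fpsC f)%:M.
Proof.
rewrite [LHS]tens_mx1_mul -map_mxM BBneg map_scalar_mx.
exact: tens_scalar_mx1.
Qed.

Let w := ((y - x) * (y - x) - x * y * (x * y)) *
  ((y + x) * (y + x) - x * y * (x * y)).

(** As series in the outer variable y, both factors have constant term x^2, a regular element. *)
Let lreg_w : GRing.lreg w.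
Proof.
have coef0M (F G : S) : fcoef (F * G) 0 = fcoef F 0 * fcoef G 0.
  by rewrite fcoefM big_ord1.
have xy0 : fcoef (x * y * (x * y)) 0 = 0 by rewrite !coef0M !mulr0.
have X2 : GRing.lreg (fpsX * fpsX : fps A) by apply: lregM; apply: lreg_fpsX.
apply: lregM; apply: lreg_fps; rewrite fcoefB xy0 subr0 coef0M.
  by rewrite fcoefB sub0r mulrNN.
by have -> : fcoef (y + x) 0 = fpsX by apply: add0r.
Qed.

Let w_comm : w%:M *m ((fpsC f)%:M *m B2v B - B2v B *m (fpsC f)%:M) = 0.
Proof.
have refl_eq' := refl_eq; rewrite R_minusE R_plusE in refl_eq'.
have := @reflection_center 'M[S]_(n * n)%N _ _ _ P (B1u B) (B1u Bneg) (fpsC f)%:M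
  (B2v B) (@scalar_minus_central A (n * n)) (@scalar_plus_central A (n * n))
  (@scalar_mul_central A (n * n)) (@flip_mxK A n) B1uBneg
  (comm_flip_scalar _ _) refl_eq' refl_eq_neg.
apply: etrans; congr (_ *m _).
exact: scalar_mx_prodB.
Qed.

(** In an entry of [w_comm] the regular series [w] cancels, leaving f(u) b_ij(v) = b_ij(v) f(u).
    Since u and v are independent, the coefficients commute pairwise. *)
Lemma reflection_central p r i j : GRing.comm (fcoef f p) (fcoef (B i j) r).
Proof.
have BE : B2v B (mxtens_index (i, i)) (mxtens_index (i, j)) = fps_map fpsC (B i j).
  by apply: etrans (tens_1mxE _ _ _ _ _) _; rewrite eqxx mxE.
pose ent (M : 'M[S]_(n * n)) := M (mxtens_index (i, i)) (mxtens_index (i, j)).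
have := etrans (esym (scalar_mx_commE _ _ _ _ _)) (congr1 ent w_comm).
rewrite BE /ent [in RHS]mxE -[0](mulr0 w) => /lreg_w/subr0_eq fB.
have L : fcoef (fcoef (fpsC f * fps_map fpsC (B i j)) r) p =
    fcoef f p * fcoef (B i j) r.
  by rewrite fcoefCM; apply: fcoefMC.
have R : fcoef (fcoef (fps_map fpsC (B i j) * fpsC f) r) p =
    fcoef (B i j) r * fcoef f p.
  by rewrite fcoefMC; apply: fcoefCM.
by rewrite /GRing.comm -L fB R.
Qed.

End ReflectionCenter.

(** * From generators and relations to the reflection algebra *)

(** Every element is a finite linear combination of words, and words grow from the empty one by
    prepending letters. *)
Lemma free_alg_ind (K : comNzRingType) (I : choiceType) (Q : free_alg K I -> Prop) :
    Q 0 -> Q 1 -> (forall a b, Q a -> Q b -> Q (a + b)) ->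
    (forall c a, Q a -> Q (c *: a)) ->
    (forall i a, Q a -> Q (free_gen K i * a)) ->
  forall a, Q a.
Proof.
move=> Q0 Q1 QD QZ QM a; rewrite [a]monalgE.
elim/big_rec: _ => [//|m b _ Qb]; apply: QD => //.
have -> : << a@_m *g m >> = a@_m *: (<< m >> : free_alg K I).
  by apply/malgP=> m'; rewrite mcoeffZ !mcoeffU mulrnAr mulr1.
apply: QZ; case: m {b Qb} => s; elim: s => [|i s IHs].
  by rewrite -fmoneE.
have -> : << FMonom (i :: s) >> = free_gen K i * << FMonom s >> :> free_alg K I.
  apply: esym; apply: etrans (malgMEw (fsubset_refl _) (fsubset_refl _)) _.
  rewrite /free_gen !msuppU1 !big_seq_fset1 !mcoeffUU mulr1; congr << _ >>.
  by apply/eqP; rewrite fmP fmM fmU.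
exact: QM.
Qed.

(** The centralizer of [z] is a subalgebra. Induction runs over a representative of [a] in the free
    algebra. *)
Lemma refl_alg_comm (K : comNzRingType) (k l : nat) (z a : refl_alg K k l) :
  (forall r i j, GRing.comm z (refl_gen K k l r.+1 i j)) -> GRing.comm z a.
Proof.
move=> zg; rewrite -[a]reprK -[X in GRing.comm z X]/(alg_proj _ _).
elim/free_alg_ind: (repr a).
- by rewrite rmorph0; apply: commr0.
- by rewrite rmorph1; apply: commr1.
- by move=> b c zb zc; rewrite rmorphD; apply: commrD.
- move=> c b zb.
  have -> : alg_proj (@refl_relation K k l) (c *: b) =
      c *: (alg_proj _ b : refl_alg K k l).
    exact/esym/alg_quot_scale_pi.
  by rewrite /GRing.comm -scalerAr -scalerAl zb.
- move=> [[r i] j] b zb.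
  have -> : alg_proj (@refl_relation K k l) (free_gen K (r, i, j) * b) =
      (alg_proj _ (free_gen K (r, i, j)) : refl_alg K k l) * alg_proj _ b.
    exact: (rmorphM (alg_proj (@refl_relation K k l))).
  apply: commrM => //.
  (* Letters carry the shifted index, so the letter (r, i, j) is the generator with superscript
     [r.+1]. *)
  exact: zg.
Qed.

(** Forming the defect commutes with the projection from the free algebra, where each coefficient of
    the defect is a defining relation. *)
Lemma reflection_defect_refl_B (K : comNzRingType) (k l : nat) :
  reflection_defect (refl_B K k l) = 0.
Proof.
pose pr : {rmorphism refl_free K k l -> refl_alg K k l} :=
  alg_proj (@refl_relation K k l).
have -> : refl_B K k l = map_mx (fps_map pr) (refl_mx (@refl_free_gen K k l)).
  apply/matrixP=> i j; rewrite !mxE; apply/fpsP=> -[|r] //=.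
  by rewrite rmorphM rmorph_nat /refl_eps; case: ifP; rewrite ?rmorphN rmorph1.
rewrite -map_reflection_defect; apply/matrixP=> I J; rewrite mxE [RHS]mxE.
apply/fpsP=> q; apply/fpsP=> p.
rewrite !fcoef_map -[RHS](rmorph0 pr); apply/eq_alg_quot.
by rewrite subr0; apply: Ideal_gen; exists I, J, p, q.
Qed.

Theorem proposition2p1 (R : realType) (k l : nat) :
  exists f : fps (refl_alg (complex R) k l),
    [/\ refl_B (complex R) k l *m map_mx (@fps_neg _) (refl_B (complex R) k l)
          = f%:M,
        fps_neg f = f
      & forall (r : nat) (a : refl_alg (complex R) k l),
          GRing.comm (fcoef f r) a].
Proof.
(* 2 is invertible among the complex scalars. *)
have two_reg (a : refl_alg (complex R) k l) : a *+ 2 = 0 -> a = 0.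
  move=> a2; rewrite -[a]scale1r -(@mulVf (complex R) 2%:R) ?Num.Theory.pnatr_eq0 //.
  by rewrite -scalerA scaler_nat a2 scaler0.
have refl0 := reflection_defect_refl_B (complex R) k l.
have [f [BB _ fneg]] := reflection_scalar refl0 two_reg.
exists f; split=> // r a; apply: refl_alg_comm => s i j.
have := reflection_central refl0 BB r s.+1 i j.
by rewrite mxE.
Qed.
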